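(* For every $m\in\mathbb{N}$, $P_m(\lambda)=\lambda\,U_{m-1}(\lambda/2)$.
   Context: For $k=(k_1,\dots,k_n)\in\{\pm1\}^n$ and $1\le i\le j\le n$, let $k(i:j):=(k_i,\dots,k_j)$ and let $q_{k(i:j)}(\lambda)$ be the determinant of the tridiagonal matrix of order $j-i+2$ with all main diagonal entries equal to $\lambda$, all entries on the first superdiagonal equal to $1$, and first subdiagonal entries $k_i,\dots,k_j$ (from top to bottom). Further set $q_{k(i:j)}(\lambda):=\lambda$ if $i-j=1$, $:=1$ if $i-j=2$, and $:=0$ if $i-j=3$. For $k\in\{\pm1\}^n$ the polynomial $p_k$ is defined by $(-1)^n p_k(\lambda)=q_{k(1:n-1)}(-\lambda)-k_n\,q_{k(2:n-2)}(-\lambda)$. For $m\ge2$, $P_m$ denotes the polynomial $p_k$ for the vector $k$ of length $m$ with $k_{m-1}=-1$, $k_m=1$ and all other entries equal to $1$; also $P_1(\lambda):=\lambda$. $U_n$ is the Chebyshev polynomial of the second kind of degree $n$: $U_0(x)=1$, $U_1(x)=2x$, $U_{n+1}(x)=2xU_n(x)-U_{n-1}(x)$ for $n\in\mathbb{N}$. *)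

(* Defs.v *)
From mathcomp Require Import all_boot all_order all_algebra.
Set Implicit Arguments.
Unset Strict Implicit.
Unset Printing Implicit Defensive.
Import GRing.Theory.
Local Open Scope ring_scope.

Section HoppingSignPolynomials.

Variable R : comNzRingType.

(* A vector k = (k_1, ..., k_n) is an n.-tuple.  Its entries are numbered from
   1, by integers a with 1 <= a <= n; other values of a are never relevant. *)
Definition entry n (k : n.-tuple R) (a : int) : R := k`_(absz (a - 1)).

(* The tridiagonal matrix of order j - i + 2 attached to k(i:j), for i <= j;
   rows and columns are numbered from 0, so the subdiagonal entry
   in column b is k_{i+b}. *)
Definition tridiag n (k : n.-tuple R) (i j : int) :
    'M[{poly R}]_(absz (j - i + 2)) :=
  \matrix_(a, b)
    if a == b then 'X
    else if b == a.+1 :> nat then 1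
    else if a == b.+1 :> nat then (entry k (i + b%:Z))%:P
    else 0.

(* The indices are integers because k(2:n-2) is k(2:-1) when n = 1. *)
Definition q n (k : n.-tuple R) (i j : int) : {poly R} :=
  if i <= j then \det (tridiag k i j)
  else if i - j == 1 then 'X
  else if i - j == 2 then 1
  else 0.

(* (-1)^n p_k(x) = q_{k(1:n-1)}(-x) - k_n q_{k(2:n-2)}(-x) *)
Definition p n (k : n.-tuple R) : {poly R} :=
  (-1) ^+ n *
  ((q k 1 (n%:Z - 1) \Po (- 'X))
   - (entry k n%:Z)%:P * (q k 2 (n%:Z - 2) \Po (- 'X))).

(* k_{m-1} = -1 and all other entries are 1 (index i < m stands for k_{i+1}). *)
Definition Pvec m : m.-tuple R :=
  [tuple (if i.+2 == m then -1 else 1) | i < m].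

Lemma Pvec_sign m (x : R) : x \in Pvec m -> x = 1 \/ x = -1.
Proof. by case/tnthP=> i ->; rewrite tnth_mktuple; case: ifP; [right|left]. Qed.

(* P 0 is not meaningful. *)
Definition P m : {poly R} := if m == 1%N then 'X else p (Pvec m).

Fixpoint U n : {poly R} :=
  match n with
  | 0 => 1
  | n'.+1 => match n' with
             | 0 => 2%:R *: 'X
             | n''.+1 => 2%:R *: 'X * U n' - U n''
             end
  end.

End HoppingSignPolynomials.

(* Main.v *)
(* Expanding along the first row gives the three-term recurrence of tridiagonal
   determinants.  Writing D_n for the determinant of order n with all
   subdiagonal entries 1, one gets D_n = U_n(x/2), while a final subdiagonal
   entry -1 turns the determinant of order m into x D_(m-1) + D_(m-2).  The
   term D_(m-2) is cancelled by q_(k(2:m-2)), and the parity of D_(m-1) absorbs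
   the sign (-1)^m. *)
Require Import Defs.
From mathcomp Require Import all_boot all_order all_algebra.
From mathcomp Require Import zify ring.
Import GRing.Theory.
Local Open Scope ring_scope.

Section Tridiagonal.

Variable R : comNzRingType.

(** With the subdiagonal as a sequence and the order as a free natural number, deleting leading rows
    and columns is just a shift of [s]. *)
Definition tridiag_mx (s : nat -> R) n : 'M[{poly R}]_n :=
  \matrix_(a, b)
    if a == b then 'X
    else if b == a.+1 :> nat then 1
    else if a == b.+1 :> nat then (s b)%:P
    else 0.

Lemma eq_det_tridiag_mx (s t : nat -> R) n :
  (forall b, (b.+1 < n)%N -> s b = t b) ->
  \det (tridiag_mx s n) = \det (tridiag_mx t n).
Proof.
move=> est; congr (\det _); apply/matrixP=> a b; rewrite !mxE.
case: ifP => // _; case: ifP => // _; case: eqP => // ab.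
by rewrite est // -ab.
Qed.

Lemma det_tridiag_mx0 (s : nat -> R) : \det (tridiag_mx s 0) = 1.
Proof. exact: det_mx00. Qed.

Lemma det_tridiag_mx1 (s : nat -> R) : \det (tridiag_mx s 1) = 'X.
Proof. by rewrite det_mx11 mxE. Qed.

Lemma det_tridiag_mxSS (s : nat -> R) n :
  \det (tridiag_mx s n.+2) =
    'X * \det (tridiag_mx (fun b => s b.+1) n.+1)
    - (s 0%N)%:P * \det (tridiag_mx (fun b => s b.+2) n).
Proof.
rewrite (expand_det_row _ ord0) !big_ord_recl big1 => [|i _]; last first.
  by rewrite mxE mul0r.
rewrite addr0 !mxE /= mul1r /cofactor /= expr0 expr1 mul1r; congr ('X * _ + _).
  by congr (\det _); apply/matrixP=> a b; rewrite !mxE.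
(* The first column of the remaining minor has [s 0] as its only nonzero entry. *)
rewrite mulN1r (expand_det_col _ ord0) big_ord_recl big1 => [|i _]; last first.
  by rewrite !mxE mul0r.
rewrite addr0 !mxE /= /cofactor /= expr0 mul1r; congr (- (_ * \det _)).
by apply/matrixP=> a b; rewrite !mxE.
Qed.

Definition path_det n : {poly R} := \det (tridiag_mx (fun=> 1) n).

Lemma path_detSS n : path_det n.+2 = 'X * path_det n.+1 - path_det n.
Proof. by rewrite /path_det det_tridiag_mxSS mul1r. Qed.

Lemma path_det_parity n : path_det n \Po - 'X = (-1) ^+ n * path_det n.
Proof.
suff: path_det n \Po - 'X = (-1) ^+ n * path_det n /\
      path_det n.+1 \Po - 'X = (-1) ^+ n.+1 * path_det n.+1 by case.
elim: n => [|n [IHn IHn1]].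
  rewrite /path_det det_tridiag_mx0 det_tridiag_mx1 comp_polyX.
  by rewrite -[1]/(1%:P) comp_polyC mul1r expr1 mulN1r.
split=> //; rewrite path_detSS comp_polyB comp_polyM comp_polyX IHn IHn1 !exprS.
by ring.
Qed.

Lemma det_tridiag_mx_last n :
  \det (tridiag_mx (fun b => if b.+2 == n.+2 then -1 else 1) n.+2) =
    'X * path_det n.+1 + path_det n.
Proof.
(* The test moves with the order, so the shift keeps the -1 in last place. Hence [E] obeys the
   recurrence of [path_det], and two initial values suffice. *)
pose E n := \det (tridiag_mx (fun b => if b.+2 == n then -1 else 1) n).
rewrite -/(E n.+2).
have E2 : E 2 = 'X * path_det 1 + path_det 0.
  by rewrite /E det_tridiag_mxSS /path_det !det_tridiag_mx0 !det_tridiag_mx1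
             /= polyCN mulN1r opprK.
have ESS j : E j.+3 = 'X * E j.+2 - E j.+1.
  by rewrite /E det_tridiag_mxSS /= mul1r.
suff: E n.+2 = 'X * path_det n.+1 + path_det n /\
      E n.+3 = 'X * path_det n.+2 + path_det n.+1 by case.
elim: n => [|n [IHn IHn1]].
  split=> //; rewrite ESS E2 path_detSS /E /path_det.
  by rewrite !det_tridiag_mx0 !det_tridiag_mx1; ring.
by split=> //; rewrite ESS IHn IHn1 !path_detSS; ring.
Qed.

Lemma entry_Pvec m b : (b < m)%N ->
  entry (Pvec R m) b.+1%:Z = if b.+2 == m then -1 else 1.
Proof.
move=> bm; rewrite /entry; have -> : absz (b.+1%:Z - 1) = b by lia.
by rewrite -[b]/(nat_of_ord (Ordinal bm)) -tnth_nth tnth_mktuple.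
Qed.

Lemma q_Pvec1 n :
  q (Pvec R n.+2) 1 (n.+2%:Z - 1) = 'X * path_det n.+1 + path_det n.
Proof.
rewrite /q; have -> : 1 <= n.+2%:Z - 1 by lia.
rewrite -det_tridiag_mx_last.
(* Holds by conversion; in this form the order, on which the matrix type depends, can be
   rewritten. *)
transitivity (\det (tridiag_mx (fun b => entry (Pvec R n.+2) (1 + b%:Z))
                      (absz (n.+2%:Z - 1 - 1 + 2)))) => //.
have -> : absz (n.+2%:Z - 1 - 1 + 2) = n.+2 by lia.
apply: eq_det_tridiag_mx => b lt_b.
have -> : 1 + b%:Z = b.+1%:Z by lia.
by rewrite entry_Pvec // ltnW.
Qed.

Lemma q_Pvec2 n : q (Pvec R n.+2) 2 (n.+2%:Z - 2) = path_det n.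
Proof.
(* For orders 0 and 1 the conventions for empty ranges give the values 1 and ['X]; beyond that, the
   range stops just before the entry -1. *)
rewrite /q; case: n => [|[|n]].
- by rewrite /path_det det_tridiag_mx0.
- by rewrite /path_det det_tridiag_mx1.
have -> : 2 <= n.+4%:Z - 2 by lia.
transitivity (\det (tridiag_mx (fun b => entry (Pvec R n.+4) (2 + b%:Z))
                      (absz (n.+4%:Z - 2 - 2 + 2)))) => //.
have -> : absz (n.+4%:Z - 2 - 2 + 2) = n.+2 by lia.
apply: eq_det_tridiag_mx => b lt_b.
have -> : 2 + b%:Z = b.+2%:Z by lia.
by rewrite entry_Pvec ?ifF //; lia.
Qed.

Lemma P_path_det n : P R n.+1 = 'X * path_det n.
Proof.
case: n => [|n]; first by rewrite /path_det det_tridiag_mx0 mulr1.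
rewrite /P /= /p entry_Pvec // ifF; last by lia.
rewrite mul1r -comp_polyB q_Pvec1 q_Pvec2 addrK comp_polyM comp_polyX.
rewrite path_det_parity [in LHS]exprS.
have sgn2 : (-1) ^+ n.+1 * (-1) ^+ n.+1 = 1 :> {poly R} by rewrite -expr2 sqrr_sign.
(* The factor -1 split off by [exprS] cancels the sign of [- 'X]. *)
transitivity ((-1) ^+ n.+1 * (-1) ^+ n.+1 * ('X * path_det n.+1)).
  by ring.
by rewrite sgn2 mul1r.
Qed.

End Tridiagonal.

(** Halving the variable turns the coefficient [2x] of the Chebyshev recurrence into [x]; 2 is
    invertible in a [numFieldType]. *)
Lemma U_half (F : numFieldType) n :
  U F n \Po (2%:R^-1 *: 'X) = path_det F n.
Proof.
have X2 : (2%:R *: 'X) \Po (2%:R^-1 *: 'X) = 'X :> {poly F}.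
  by rewrite comp_polyZ comp_polyX scalerA divff ?scale1r // Num.Theory.pnatr_eq0.
suff: U F n \Po (2%:R^-1 *: 'X) = path_det F n /\
      U F n.+1 \Po (2%:R^-1 *: 'X) = path_det F n.+1 by case.
elim: n => [|n [IHn IHn1]].
  rewrite /path_det det_tridiag_mx0 det_tridiag_mx1 X2.
  by rewrite -[U F 0]/(1%:P) comp_polyC.
split=> //; rewrite path_detSS -IHn -IHn1.
by rewrite -[U F n.+2]/(2%:R *: 'X * U F n.+1 - U F n) comp_polyB comp_polyM X2.
Qed.

Theorem lemma3p5 (F : numFieldType) (m : nat) (hm : (0 < m)%N) :
  P F m = 'X * (U F m.-1 \Po (2%:R^-1 *: 'X)).
Proof. by case: m hm => // n _; rewrite P_path_det U_half. Qed.
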